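(* $\mathsf{TT}^2_2$ does not admit fairness preservation. More precisely, there are a $\Delta^0_2$ partition $A_0\cup A_1=2^{<\omega}$ such that $\emptyset$ is $1$-fair for $A_0,A_1$, and a computable coloring $f:[2^{<\omega}]^2\to 2$, with the following property: for every $f$-homogeneous set $S$ (and witnessing isomorphism $g$), the set $S$ is not $n$-fair for $A_0,A_1$ for any $n\ge1$.
   Context: $[2^{<\omega}]^2$ denotes the set of pairs $\{\sigma,\tau\}$ of binary strings with $\sigma\prec\tau$. A set $S\subseteq 2^{<\omega}$ is $f$-homogeneous if $f$ is constant on $[S]^2$ and $S\cong 2^{<\omega}$, witnessed by a bijection $g:2^{<\omega}\to S$ with $\sigma\preceq\tau\iff g(\sigma)\preceq g(\tau)$. $\mathsf{TT}^2_2$ is the statement that every $f:[2^{<\omega}]^2\to2$ has an $f$-homogeneous set; a solution is such a set together with its isomorphism $g$. Strings are finite binary strings, and $\preceq$ is the prefix relation. Matrices. An $m$-by-$n$ matrix $M$ is an array of strings $\sigma_{i,j}$ ($i<m$, $j<n$), with rows $M(i)=(\sigma_{i,0},\dots,\sigma_{i,n-1})$. It is disjoint if each row consists of pairwise incomparable strings. Formulas. An $m$-by-$n$ formula is a formula with distinguished finite-set variables $U_{i,j}$. It is $\Sigma^{0,X}_1$ if it is $\Sigma^0_1$ relative to $X$. Valuations. An $M$-valuation is a tuple $V=(B_{i,j})$ of finite sets $B_{i,j}\subseteq\{\tau:\tau\succeq\sigma_{i,j}\}$. We write $\varphi(V)$ for $\varphi$ evaluated at $U_{i,j}:=B_{i,j}$,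 and $V(i)=(B_{i,0},\dots,B_{i,n-1})$. We write $V>s$ if all strings occurring in $V$ have length $>s$. Essential. $\varphi$ is essential in $M$ if for every $s$ there is an $M$-valuation $V>s$ with $\varphi(V)$. Diagonalization. An $M$-valuation $V$ diagonalizes against $A_0,A_1$ if for every $i<m$ there are components $L,R$ of $V(i)$ with $L\subseteq A_0$ and $R\subseteq A_1$. Fairness. For $n\ge1$, a set $X$ is $n$-fair for $A_0,A_1$ if the following holds: for every $m$, every $\Sigma^{0,X}_1$ $m$-by-$2^nm$ formula $\varphi$, and every $m$-by-$2^nm$ disjoint matrix $M$ in which $\varphi$ is essential, there is an $M$-valuation $V$ diagonalizing against $A_0,A_1$ with $\varphi(V)$. The set $X$ is fair if it is $n$-fair for some $n\ge1$. Preservation. A $\Pi^1_2$ problem $\mathsf P$ admits fairness preservation if for all $A_0,A_1\subseteq2^{<\omega}$, every $C$ fair for $A_0,A_1$, and every $C$-computable $\mathsf P$-instance $X$, there is a solution $Y$ to $X$ with $Y\oplus C$ fair for $A_0,A_1$. *)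

(* Defs.v *)
From mathcomp Require Import all_boot.
Set Implicit Arguments. Unset Strict Implicit. Unset Printing Implicit Defensive.

Inductive code : Type :=
| cZero
| cSucc
| cProj of nat
| cOracle
| cComp of code & list code
| cPrec of code & code
| cMu of code.

Inductive eval (O : nat -> Prop) : code -> seq nat -> nat -> Prop :=
| ev_zero xs : eval O cZero xs 0
| ev_succ x xs : eval O cSucc (x :: xs) x.+1
| ev_proj i xs : i < size xs -> eval O (cProj i) xs (nth 0 xs i)
| ev_orac1 x xs : O x -> eval O cOracle (x :: xs) 1
| ev_orac0 x xs : ~ O x -> eval O cOracle (x :: xs) 0
| ev_comp f gs xs ys v :
    evals O gs xs ys -> eval O f ys v -> eval O (cComp f gs) xs v
| ev_prec0 f g xs v : eval O f xs v -> eval O (cPrec f g) (0 :: xs) v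
| ev_precS f g y xs w v :
    eval O (cPrec f g) (y :: xs) w -> eval O g (y :: w :: xs) v ->
    eval O (cPrec f g) (y.+1 :: xs) v
| ev_mu f xs y :
    eval O f (y :: xs) 0 ->
    (forall z, z < y -> exists w, eval O f (z :: xs) w.+1) ->
    eval O (cMu f) xs y
with evals (O : nat -> Prop) : list code -> seq nat -> seq nat -> Prop :=
| evs_nil xs : evals O nil xs [::]
| evs_cons g gs xs v vs :
    eval O g xs v -> evals O gs xs vs -> evals O (g :: gs) xs (v :: vs).

Definition halts (O : nat -> Prop) (c : code) (xs : seq nat) : Prop :=
  exists v, eval O c xs v.

Definition empty_oracle : nat -> Prop := fun _ => False.

Definition str := seq bool.

(* bijective base-2 coding of strings as naturals *)
Fixpoint enc (s : str) : nat :=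
  match s with
  | [::] => 0
  | b :: s' => (enc s').*2 + (if b then 2 else 1)
  end.

Definition str_oracle (S : str -> Prop) : nat -> Prop :=
  fun n => exists s, enc s = n /\ S s.

Definition sprefix (s t : str) : bool := prefix s t && (s != t).

Definition incomparable (s t : str) : bool := ~~ prefix s t && ~~ prefix t s.

Definition Sigma2_str (P : str -> Prop) : Prop :=
  exists c, (forall x a b, exists v, eval empty_oracle c [:: x; a; b] v) /\
    forall s, P s <-> exists a, forall b, eval empty_oracle c [:: enc s; a; b] 1.

Definition Delta2_str (P : str -> Prop) : Prop :=
  Sigma2_str P /\ Sigma2_str (fun s => ~ P s).

(* An m-by-k matrix: entries M i j for i < m, j < k. *)
Definition matrix := nat -> nat -> str.
(* A tuple of finite sets of strings, V i j = B_{i,j} (finite set given as a list). *)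
Definition valuation := nat -> nat -> seq str.

Definition disjoint_matrix (m k : nat) (M : matrix) : Prop :=
  forall i j1 j2, i < m -> j1 < k -> j2 < k -> j1 != j2 -> incomparable (M i j1) (M i j2).

Definition is_valuation (m k : nat) (M : matrix) (V : valuation) : Prop :=
  forall i j, i < m -> j < k -> forall t, t \in V i j -> prefix (M i j) t.

Definition val_gt (m k : nat) (V : valuation) (s : nat) : Prop :=
  forall i j, i < m -> j < k -> forall t, t \in V i j -> s < size t.

Definition setcode (B : seq str) : nat := \sum_(t <- undup B) 2 ^ enc t.

Definition valcode (m k : nat) (V : valuation) : seq nat :=
  flatten [seq [seq setcode (V i j) | j <- iota 0 k] | i <- iota 0 m].

Definition sigma1_formula (X : nat -> Prop) (m k : nat) (phi : valuation -> Prop) : Prop :=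
  exists c, forall V, phi V <-> halts X c (valcode m k V).

Definition essential (m k : nat) (phi : valuation -> Prop) (M : matrix) : Prop :=
  forall s, exists V, [/\ is_valuation m k M V, val_gt m k V s & phi V].

Definition diagonalizes (m k : nat) (V : valuation) (A0 A1 : str -> Prop) : Prop :=
  forall i, i < m -> exists L R, [/\ L < k, R < k,
    (forall t, t \in V i L -> A0 t) & (forall t, t \in V i R -> A1 t)].

Definition n_fair (n : nat) (X : nat -> Prop) (A0 A1 : str -> Prop) : Prop :=
  forall (m : nat) (phi : valuation -> Prop) (M : matrix),
    sigma1_formula X m (2 ^ n * m) phi ->
    disjoint_matrix m (2 ^ n * m) M ->
    essential m (2 ^ n * m) phi M ->
    exists V, [/\ is_valuation m (2 ^ n * m) M V,
                  diagonalizes m (2 ^ n * m) V A0 A1 & phi V].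

Definition computable_coloring (f : str -> str -> bool) : Prop :=
  exists c, forall s t, eval empty_oracle c [:: enc s; enc t] (nat_of_bool (f s t)).

Definition homogeneous (f : str -> str -> bool) (S : str -> Prop) (g : str -> str) : Prop :=
  [/\ (exists col : bool, forall s t, S s -> S t -> sprefix s t -> f s t = col),
      (forall s, S (g s)),
      (forall t, S t -> exists s, g s = t),
      injective g &
      (forall s t, prefix s t = prefix (g s) (g t))].

(* Main.v *)
Require Import Defs.
From mathcomp Require Import all_boot.
From mathcomp Require Import zify.
From Stdlib Require Import Classical ClassicalEpsilon.
Set Implicit Arguments. Unset Strict Implicit. Unset Printing Implicit Defensive.

(** The set [A0] is a 1-generic set below 0': at stage [s] of a finite-extension
construction, the [e]-th step looks for the least witness below [s] that some
condition extending the current one enters the [e]-th semidecidable set of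
conditions.  This approximation is computable and converges, and [A0] is its limit.

1-genericity gives 1-fairness of the empty oracle.  In a disjoint [m]-by-[2m] matrix
one can choose two columns [L i], [R i] in every row so that the chosen strings are
pairwise incomparable; the conditions that force [V i (L i)] into [A0] and
[V i (R i)] out of [A0] for some valuation [V] satisfying the formula are then dense
as soon as the formula is essential.

Colour [(s, t)] by the approximation to [A0 s] at stage [t].  Along a homogeneous [S]
the limit is the colour of [S], hence [S] lies inside [A0] or inside [A1].  The
formula "every component meets [S]", with incomparable elements of [S] as its
one-row matrix, is essential but has no diagonalizing valuation. *)

(** * Computable functions *)

Section EvalInduction.
Variables (O : nat -> Prop) (P : code -> seq nat -> nat -> Prop).
Variable (Q : seq code -> seq nat -> seq nat -> Prop).
Hypothesis Pzero : forall xs, P cZero xs 0.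
Hypothesis Psucc : forall x xs, P cSucc (x :: xs) x.+1.
Hypothesis Pproj : forall i xs, i < size xs -> P (cProj i) xs (nth 0 xs i).
Hypothesis Porac1 : forall x xs, O x -> P cOracle (x :: xs) 1.
Hypothesis Porac0 : forall x xs, ~ O x -> P cOracle (x :: xs) 0.
Hypothesis Pcomp : forall f gs xs ys v, Q gs xs ys -> P f ys v -> P (cComp f gs) xs v.
Hypothesis Pprec0 : forall f g xs v, P f xs v -> P (cPrec f g) (0 :: xs) v.
Hypothesis PprecS : forall f g y xs w v,
  P (cPrec f g) (y :: xs) w -> P g (y :: w :: xs) v -> P (cPrec f g) (y.+1 :: xs) v.
Hypothesis Pmu : forall f xs y, P f (y :: xs) 0 ->
  (forall z, z < y -> exists w, P f (z :: xs) w.+1) -> P (cMu f) xs y.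
Hypothesis Qnil : forall xs, Q nil xs nil.
Hypothesis Qcons : forall g gs xs v vs, P g xs v -> Q gs xs vs -> Q (g :: gs) xs (v :: vs).

(** The premise of [ev_mu] keeps its derivations under [exists w], so the recursion opens each
    existential and calls itself on the derivation inside. *)
Fixpoint eval_mutind c xs v (H : eval O c xs v) : P c xs v :=
  match H with
  | ev_zero xs => Pzero xs
  | ev_succ x xs => Psucc x xs
  | ev_proj _ _ lt => Pproj lt
  | ev_orac1 _ _ Ox => Porac1 _ Ox
  | ev_orac0 _ _ Ox => Porac0 _ Ox
  | ev_comp _ _ _ _ _ Hg Hf => Pcomp (evals_mutind Hg) (eval_mutind Hf)
  | ev_prec0 _ _ _ _ Hf => Pprec0 _ (eval_mutind Hf)
  | ev_precS _ _ _ _ _ _ Hw Hv => PprecS (eval_mutind Hw) (eval_mutind Hv)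
  | ev_mu _ _ _ H0 Hl => Pmu (eval_mutind H0) (fun z lt =>
       let: ex_intro w Hw := Hl z lt in ex_intro _ w (eval_mutind Hw))
  end
with evals_mutind gs xs vs (H : evals O gs xs vs) : Q gs xs vs :=
  match H with
  | evs_nil xs => Qnil xs
  | evs_cons _ _ _ _ _ Hv Hvs => Qcons (eval_mutind Hv) (evals_mutind Hvs)
  end.

Lemma eval_evals_ind : (forall c xs v, eval O c xs v -> P c xs v) /\
  (forall gs xs vs, evals O gs xs vs -> Q gs xs vs).
Proof. by split; [exact: eval_mutind | exact: evals_mutind]. Qed.

End EvalInduction.

(** For [cMu], of two different results the smaller would be an argument where [f] takes both the
    value 0 and a successor value. *)
Lemma eval_evals_fun O :
  (forall c xs v, eval O c xs v -> forall v', eval O c xs v' -> v = v') /\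
  (forall gs xs vs, evals O gs xs vs -> forall vs', evals O gs xs vs' -> vs = vs').
Proof.
apply: eval_evals_ind.
- by move=> xs v' H; inversion H.
- by move=> x xs v' H; inversion H.
- by move=> i xs _ v' H; inversion H.
- by move=> x xs Ox v' H; inversion H.
- by move=> x xs Ox v' H; inversion H.
- move=> f gs xs ys v IHg IHf v' H; inversion H as [| | | | |? ? ? ys' ? Hg' Hf'| | |]; subst.
  by move: Hf'; rewrite -(IHg _ Hg') => /IHf.
- by move=> f g xs v IHf v' H; inversion H as [| | | | | |? ? ? ? Hf'| |]; subst; exact: IHf.
- move=> f g y xs w v IHw IHv v' H.
  inversion H as [| | | | | | |? ? ? ? w' ? Hw' Hv'|]; subst.
  by move: Hv'; rewrite -(IHw _ Hw') => /IHv.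
- move=> f xs y IH0 IHl v' H; inversion H as [| | | | | | | |? ? ? H0' Hl']; subst.
  case: (ltngtP y v') => // lt.
    by case: (Hl' _ lt) => w /IH0.
  by case: (IHl _ lt) => w /(_ _ H0').
- by move=> xs v' H; inversion H.
- move=> g gs xs v vs IHv IHvs v' H; inversion H as [|? ? ? ? ? Hv' Hvs']; subst.
  by rewrite (IHv _ Hv') (IHvs _ Hvs').
Qed.

Lemma eval_fun O c xs v v' : eval O c xs v -> eval O c xs v' -> v = v'.
Proof. by move=> H; exact: (proj1 (eval_evals_fun O) _ _ _ H). Qed.

(** * The Cantor pairing function *)

Fixpoint tri n := if n is m.+1 then tri m + m.+1 else 0.
(** The antidiagonal on which [p] lies, that is, the largest [d] with [tri d <= p]. It grows by one
    exactly when the next triangular number is reached, which makes it primitive recursive. *)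
Fixpoint diag p := if p is q.+1 then diag q + (tri (diag q).+1 <= q.+1) else 0.

Definition pair a b := tri (a + b) + b.
Definition p2 p := p - tri (diag p).
Definition p1 p := diag p - p2 p.

Lemma diag_bounds p : tri (diag p) <= p < tri (diag p).+1.
Proof.
elim: p => [|p IH] //; rewrite [diag p.+1]/=; move: IH.
case: (leqP (tri (diag p).+1) p.+1); rewrite ?addn0 ?addn1 /=; lia.
Qed.

Lemma leq_tri m n : m <= n -> tri m <= tri n.
Proof. by move=> /subnK <-; elim: (n - m) => [|d IH] //; rewrite addSn /=; lia. Qed.

Lemma diag_pair a b : diag (pair a b) = a + b.
Proof.
have /andP[l u] := diag_bounds (pair a b); apply/eqP; rewrite eqn_leq.
have B : tri (a + b) <= pair a b < tri (a + b).+1 by rewrite /pair /=; lia.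
apply/andP; split; rewrite leqNgt; apply/negP => /leq_tri; lia.
Qed.

Lemma p2K a b : p2 (pair a b) = b.
Proof. by rewrite /p2 diag_pair /pair addKn. Qed.
Lemma p1K a b : p1 (pair a b) = a.
Proof. by rewrite /p1 p2K diag_pair addnK. Qed.
Lemma pairK p : pair (p1 p) (p2 p) = p.
Proof.
have /andP[l u] := diag_bounds p; rewrite /pair /p1.
have le : p2 p <= diag p by move: u; rewrite /p2 /=; lia.
by rewrite subnK // /p2 subnKC.
Qed.
Lemma leq_p2 p : p2 p <= p. Proof. exact: leq_subr. Qed.

(** * Closure properties of the computable functions *)

Section Computable.
Variable O : nat -> Prop.

(** Only unary functions are treated; further arguments are packed with [pair], and predicates enter
    as 0-1 functions through the coercion from [bool]. *)
Definition computable (F : nat -> nat) := exists c, forall x, eval O c [:: x] (F x).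
Definition computable2 (F : nat -> nat -> nat) := computable (fun p => F (p1 p) (p2 p)).

Let c_add := cPrec (cProj 0) (cComp cSucc [:: cProj 1]).
Let c_pred := cPrec cZero (cProj 0).
(** Primitive recursion runs on the first argument, so subtraction is first obtained with its
    arguments swapped. *)
Let c_rsub := cPrec (cProj 0) (cComp c_pred [:: cProj 1]).
Let c_sub := cComp c_rsub [:: cProj 1; cProj 0].
Let c_tri := cPrec cZero (cComp c_add [:: cProj 1; cComp cSucc [:: cProj 0]]).
Let c_one := cComp cSucc [:: cZero].
Let c_diag := cPrec cZero (cComp c_add [:: cProj 1;
   cComp c_sub [:: c_one;
   cComp c_sub [:: cComp c_tri [:: cComp cSucc [:: cProj 1]]; cComp cSucc [:: cProj 0]]]]).

Lemma ev_proj_eq i xs v : i < size xs -> nth 0 xs i = v -> eval O (cProj i) xs v.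
Proof. by move=> lt <-; exact: ev_proj. Qed.

Lemma ev_comp1 f g xs a v : eval O g xs a -> eval O f [:: a] v -> eval O (cComp f [:: g]) xs v.
Proof. by move=> Hg; apply: ev_comp; apply: evs_cons Hg _; apply: evs_nil. Qed.
Lemma ev_comp2 f g h xs a b v : eval O g xs a -> eval O h xs b ->
  eval O f [:: a; b] v -> eval O (cComp f [:: g; h]) xs v.
Proof.
by move=> Hg Hh; apply: ev_comp; apply: evs_cons Hg _; apply: evs_cons Hh _; apply: evs_nil.
Qed.

Lemma ev_add x y : eval O c_add [:: x; y] (x + y).
Proof.
elim: x => [|x IH]; first by apply: ev_prec0; exact: ev_proj_eq.
by apply: ev_precS IH _; apply: ev_comp1 (ev_succ _ _ _); exact: ev_proj_eq.
Qed.
Lemma ev_pred x : eval O c_pred [:: x] x.-1.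
Proof.
elim: x => [|x IH]; first by apply: ev_prec0; exact: ev_zero.
by apply: ev_precS IH _; exact: ev_proj_eq.
Qed.
Lemma ev_rsub y x : eval O c_rsub [:: y; x] (x - y).
Proof.
elim: y => [|y IH]; first by rewrite subn0; apply: ev_prec0; exact: ev_proj_eq.
by apply: ev_precS IH _; rewrite subnS; apply: ev_comp1 (ev_pred _); exact: ev_proj_eq.
Qed.
Lemma ev_sub x y : eval O c_sub [:: x; y] (x - y).
Proof. by apply: ev_comp2 (ev_rsub _ _); exact: ev_proj_eq. Qed.
Lemma ev_tri x : eval O c_tri [:: x] (tri x).
Proof.
elim: x => [|x IH]; first by apply: ev_prec0; exact: ev_zero.
apply: ev_precS IH _; apply: ev_comp2 (ev_add _ _); first exact: ev_proj_eq.
by apply: ev_comp1 (ev_succ _ _ _); exact: ev_proj_eq.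
Qed.
Lemma ev_one xs : eval O c_one xs 1.
Proof. by apply: ev_comp1 (ev_succ _ _ _); exact: ev_zero. Qed.
Lemma ev_diag x : eval O c_diag [:: x] (diag x).
Proof.
elim: x => [|x IH]; first by apply: ev_prec0; exact: ev_zero.
apply: ev_precS IH _; apply: ev_comp2 (ev_add _ _); first exact: ev_proj_eq.
(* Truncated subtraction decides the order: [a <= b] is [1 - (a - b)]. *)
have -> : (tri (diag x).+1 <= x.+1) = 1 - (tri (diag x).+1 - x.+1) :> nat by lia.
apply: ev_comp2 (ev_sub _ _); first exact: ev_one.
apply: ev_comp2 (ev_sub _ _); last by apply: ev_comp1 (ev_succ _ _ _); exact: ev_proj_eq.
by apply: ev_comp1 (ev_tri _); apply: ev_comp1 (ev_succ _ _ _); exact: ev_proj_eq.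
Qed.

Lemma pair_code : exists c, forall x y, eval O c [:: x; y] (pair x y).
Proof.
exists (cComp c_add [:: cComp c_tri [:: c_add]; cProj 1]) => x y.
apply: ev_comp2 (ev_add _ _); last exact: ev_proj_eq.
by apply: ev_comp1 (ev_tri _); exact: ev_add.
Qed.

Lemma comp_ext F G : F =1 G -> computable F -> computable G.
Proof. by move=> E [c Hc]; exists c => x; rewrite -E. Qed.
Lemma comp_id : computable (fun x => x).
Proof. by exists (cProj 0) => x; exact: ev_proj_eq. Qed.
Lemma comp_const k : computable (fun _ => k).
Proof.
elim: k => [|k [c Hc]]; first by exists cZero => x; exact: ev_zero.
by exists (cComp cSucc [:: c]) => x; exact: ev_comp1 (ev_succ _ _ _).
Qed.
Lemma comp_comp F G : computable G -> computable F -> computable (fun x => G (F x)).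
Proof.
move=> [g Hg] [f Hf]; exists (cComp g [:: f]) => x; exact: ev_comp1 (Hg _).
Qed.
Lemma comp_bin c op F G : (forall x y, eval O c [:: x; y] (op x y)) ->
  computable F -> computable G -> computable (fun x => op (F x) (G x)).
Proof.
by move=> Hc [f Hf] [g Hg]; exists (cComp c [:: f; g]) => x; exact: ev_comp2 (Hc _ _).
Qed.
Lemma comp_succ F : computable F -> computable (fun x => (F x).+1).
Proof. by apply: (@comp_comp F); exists cSucc => x; exact: ev_succ. Qed.
Lemma comp_pred F : computable F -> computable (fun x => (F x).-1).
Proof. by apply: (@comp_comp F); exists c_pred => x; exact: ev_pred. Qed.
Lemma comp_add F G : computable F -> computable G -> computable (fun x => F x + G x).
Proof. exact: comp_bin ev_add. Qed.
Lemma comp_sub F G : computable F -> computable G -> computable (fun x => F x - G x).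
Proof. exact: comp_bin ev_sub. Qed.
Lemma comp_pair F G : computable F -> computable G -> computable (fun x => pair (F x) (G x)).
Proof.
move=> cF cG; apply: (comp_add _ cG); apply: (@comp_comp (fun x => F x + G x) tri).
  by exists c_tri => x; exact: ev_tri.
exact: comp_add.
Qed.
Lemma comp_diag F : computable F -> computable (fun x => diag (F x)).
Proof. by apply: (@comp_comp F); exists c_diag => x; exact: ev_diag. Qed.
Lemma comp_p2 F : computable F -> computable (fun x => p2 (F x)).
Proof.
move=> cF; apply: comp_sub => //.
apply: (@comp_comp (fun x => diag (F x)) tri); last exact: comp_diag.
by exists c_tri => x; exact: ev_tri.
Qed.
Lemma comp_p1 F : computable F -> computable (fun x => p1 (F x)).
Proof. by move=> cF; apply: comp_sub; [exact: comp_diag | exact: comp_p2]. Qed.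
Lemma comp_comp2 op F G : computable2 op -> computable F -> computable G ->
  computable (fun x => op (F x) (G x)).
Proof.
move=> cop cF cG; apply: comp_ext (comp_comp cop (comp_pair cF cG)) => x.
by rewrite p1K p2K.
Qed.

(** The parameter [x] travels behind the counter and the accumulator of [cPrec]; each round repacks
    the three into the single input of the code of [B]. Conditionals and bounded searches are
    derived from this lemma. *)
Lemma comp_iteri N B I : computable N -> computable I ->
  computable (fun p => B (p1 p) (p1 (p2 p)) (p2 (p2 p))) ->
  computable (fun x => iteri (N x) (B x) (I x)).
Proof.
move=> [n Hn] [i Hi] [b Hb]; have [pr Hpr] := pair_code.
exists (cComp (cPrec i (cComp b [:: cComp pr [:: cProj 2; cComp pr [:: cProj 0; cProj 1]]]))
   [:: n; cProj 0]) => x.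
apply: ev_comp2 (Hn x) (@ev_proj_eq 0 [:: x] x _ _) _ => //.
elim: (N x) => [|k IH]; first exact: ev_prec0.
apply: ev_precS IH _; move: (Hb (pair x (pair k (iteri k (B x) (I x))))).
rewrite !(p1K, p2K) /= => H; apply: ev_comp1 H; apply: ev_comp2 (Hpr _ _); first exact: ev_proj_eq.
by apply: ev_comp2 (Hpr _ _); exact: ev_proj_eq.
Qed.

Lemma comp_iter N B I : computable N -> computable I -> computable2 B ->
  computable (fun x => iter (N x) (B x) (I x)).
Proof.
move=> cN cI cB; have H : computable (fun p => B (p1 p) (p2 (p2 p))).
  by apply: (comp_comp2 cB); [apply: comp_p1 | do 2!apply: comp_p2]; exact: comp_id.
apply: comp_ext (comp_iteri (B := fun x _ => B x) cN cI H) => x.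
by elim: (N x) => //= n ->.
Qed.

(** A conditional is an iteration of length 0 or 1 that starts at [G x] and overwrites it with
    [F x]. *)
Lemma comp_if (B : nat -> bool) F G : computable (fun x => B x) -> computable F -> computable G ->
  computable (fun x => if B x then F x else G x).
Proof.
move=> cB cF cG.
have H : computable2 (fun x _ => F x).
  by apply: (@comp_comp p1 F) => //; apply: comp_p1; exact: comp_id.
by apply: comp_ext (comp_iter cB cG H) => x; case: (B x).
Qed.

Lemma comp_leq F G : computable F -> computable G -> computable (fun x => F x <= G x).
Proof.
move=> cF cG; apply: comp_ext (comp_sub (comp_const 1) (comp_sub cF cG)) => x; lia.
Qed.
Lemma comp_eq F G : computable F -> computable G -> computable (fun x => F x == G x).
Proof.
move=> cF cG; apply: comp_ext
 (comp_sub (comp_const 1) (comp_add (comp_sub cF cG) (comp_sub cG cF))) => x; lia.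
Qed.
Lemma comp_and (B C : nat -> bool) : computable (fun x => B x) -> computable (fun x => C x) ->
  computable (fun x => B x && C x).
Proof.
move=> cB cC; apply: comp_ext (comp_if cB cC (comp_const 0)) => x; by case: (B x).
Qed.
Lemma comp_neg (B : nat -> bool) : computable (fun x => B x) -> computable (fun x => ~~ B x).
Proof.
move=> cB; apply: comp_ext (comp_sub (comp_const 1) cB) => x; by case: (B x).
Qed.
Lemma comp_imp (B C : nat -> bool) : computable (fun x => B x) -> computable (fun x => C x) ->
  computable (fun x => B x ==> C x).
Proof.
move=> cB cC; apply: comp_ext (comp_if cB cC (comp_const 1)) => x; by case: (B x).
Qed.
Lemma comp_eqb (B C : nat -> bool) : computable (fun x => B x) -> computable (fun x => C x) ->
  computable (fun x => B x == C x).
Proof.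
move=> cB cC; apply: comp_ext (comp_eq cB cC) => x; by case: (B x); case: (C x).
Qed.

Lemma comp_find (P : nat -> nat -> bool) N : computable2 (fun x y => P x y) -> computable N ->
  computable (fun x => find (P x) (iota 0 (N x))).
Proof.
move=> cP cN.
(* The accumulator [w] is the result of the search below [y]: it is less than [y] if a witness has
   been found and equals [y] otherwise. *)
pose B x y w := if w < y then w else if P x y then y else y.+1.
have cB : computable (fun p => B (p1 p) (p1 (p2 p)) (p2 (p2 p))).
  have c1 := comp_p1 comp_id; have c2 := comp_p1 (comp_p2 comp_id).
  have c3 := comp_p2 (comp_p2 comp_id).
  apply: comp_if (comp_leq (comp_succ c3) c2) c3 _.
  by apply: comp_if (comp_comp2 cP c1 c2) c2 (comp_succ c2).
apply: comp_ext (comp_iteri cN (comp_const 0) cB) => x.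
elim: (N x) => [|n IH] //; rewrite -[n.+1 in RHS]addn1 iotaD find_cat [LHS]/= IH /B size_iota.
have:= has_find (P x) (iota 0 n); have := find_size (P x) (iota 0 n).
rewrite size_iota => le ->; case: ltnP => // ge.
by rewrite /=; case: (P x n); rewrite ?addn0 ?addn1.
Qed.

Lemma comp_all (P : nat -> nat -> bool) N : computable2 (fun x y => P x y) -> computable N ->
  computable (fun x => all (P x) (iota 0 (N x))).
Proof.
move=> cP cN; have cF := comp_find (P := fun x y => ~~ P x y) (comp_neg cP) cN.
apply: comp_ext (comp_leq cN cF) => x; rewrite -{1}(size_iota 0 (N x)).
by rewrite leqNgt -(has_find (fun y => ~~ P x y)) has_predC negbK.
Qed.

Lemma comp_half F : computable F -> computable (fun x => (F x)./2).
Proof.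
apply: (@comp_comp F (fun n => n./2)).
have H : computable (fun p => p1 (p2 p) - p2 (p2 p)).
  by apply: comp_sub; [apply: comp_p1 | apply: comp_p2]; apply: comp_p2; exact: comp_id.
apply: comp_ext (comp_iteri (B := fun _ y w => y - w) comp_id (comp_const 0) H) => x.
by elim: x => //= n ->; lia.
Qed.
Lemma comp_odd F : computable F -> computable (fun x => odd (F x)).
Proof.
apply: (@comp_comp F (fun n => odd n)).
have H : computable2 (fun _ w => 1 - w).
  by apply: comp_sub; [apply: comp_const | apply: comp_p2; exact: comp_id].
apply: comp_ext (comp_iter comp_id (comp_const 0) H) => x.
by elim: x => //= n ->; case: odd.
Qed.

(** Binary digits make a number into a finite set of naturals, the same coding that [setcode]
    uses. *)
Definition bit x n := odd (iter x half n).
Lemma comp_bit F G : computable F -> computable G -> computable (fun x => bit (F x) (G x)).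
Proof.
move=> cF cG; apply: comp_odd; apply: comp_iter => //.
by apply: comp_half; apply: comp_p2; exact: comp_id.
Qed.

End Computable.

#[global] Opaque pair p1 p2.

(** The closure lemma is chosen by the head of the function body. [comp_auto] tries the context
    first, so a compound function already known to be computable is used as a block. *)
Ltac comp_step :=
  lazymatch goal with
  | |- computable2 _ _ => unfold computable2; cbv beta
  | |- computable _ ?G => lazymatch G with
    | (fun x => x) => exact: comp_id
    | (fun _ => ?c) => exact: comp_const
    | p1 => exact: (comp_p1 (comp_id _))
    | p2 => exact: (comp_p2 (comp_id _))
    | (fun x => (@?F x).+1) => refine (@comp_succ _ F _)
    | (fun x => predn (@?F x)) => refine (@comp_pred _ F _)
    | (fun x => (@?F x) + (@?H x)) => refine (@comp_add _ F H _ _)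
    | (fun x => (@?F x) - (@?H x)) => refine (@comp_sub _ F H _ _)
    | (fun x => pair (@?F x) (@?H x)) => refine (@comp_pair _ F H _ _)
    | (fun x => p1 (@?F x)) => refine (@comp_p1 _ F _)
    | (fun x => p2 (@?F x)) => refine (@comp_p2 _ F _)
    | (fun x => half (@?F x)) => refine (@comp_half _ F _)
    | (fun x => iter (@?N x) (@?B x) (@?I x)) => refine (@comp_iter _ N B I _ _ _)
    | (fun x => iteri (@?N x) (@?B x) (@?I x)) => refine (@comp_iteri _ N B I _ _ _)
    | (fun x => find (@?P x) (iota 0 (@?N x))) => refine (@comp_find _ P N _ _)
    | (fun x => nat_of_bool (all (@?P x) (iota 0 (@?N x)))) => refine (@comp_all _ P N _ _)
    | (fun x => nat_of_bool (bit (@?F x) (@?H x))) => refine (@comp_bit _ F H _ _)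
    | (fun x => nat_of_bool (odd (@?F x))) => refine (@comp_odd _ F _)
    | (fun x => nat_of_bool (@eq_op _ (@?F x) (@?H x))) =>
        first [refine (@comp_eq _ F H _ _) | refine (@comp_eqb _ F H _ _)]
    | (fun x => nat_of_bool (leq (@?F x) (@?H x))) => refine (@comp_leq _ F H _ _)
    | (fun x => nat_of_bool (andb (@?F x) (@?H x))) => refine (@comp_and _ F H _ _)
    | (fun x => nat_of_bool (implb (@?F x) (@?H x))) => refine (@comp_imp _ F H _ _)
    | (fun x => nat_of_bool (negb (@?F x))) => refine (@comp_neg _ F _)
    | (fun x => match _ with true => _ | false => _ end) => refine (@comp_if _ _ _ _ _ _ _)
    end
  end; cbv beta.
Ltac comp_auto := repeat (assumption || comp_step).

(** * A universal machine *)

(** The number 0 is the empty list and every successor is a cons, so each natural codes exactly one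
    list. *)
Definition lcons x l := (pair x l).+1.
Definition lhd l := p1 l.-1.
Definition ltl l := p2 l.-1.
Definition encl (xs : seq nat) : nat := foldr lcons 0 xs.

Lemma lhdK x l : lhd (lcons x l) = x. Proof. exact: p1K. Qed.
Lemma ltlK x l : ltl (lcons x l) = l. Proof. exact: p2K. Qed.

Lemma encl_surj l : exists xs, encl xs = l.
Proof.
elim/ltn_ind: l => -[|l] IH; first by exists [::].
have [xs E] := IH (p2 l) (leq_p2 l); exists (p1 l :: xs).
by rewrite /= E /lcons pairK.
Qed.

Fixpoint encc (c : code) : nat :=
  match c with
  | cZero => pair 0 0
  | cSucc => pair 1 0
  | cProj i => pair 2 i
  | cOracle => pair 3 0
  | cComp f gs => pair 4 (pair (encc f) (encl (map encc gs)))
  | cPrec f g => pair 5 (pair (encc f) (encc g))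
  | cMu f => pair 6 (encc f)
  end.

(* Machine states.  In mode 0 the code [a] is to be evaluated on the inputs [b], in mode 1
   the list of codes [a] is, and in mode 2 the value (or list of values) [a] is returned;
   [K] is the list of pending frames.  Mode 3 is a dead end, reached when an input that
   the code needs is missing. *)
Definition st m a b K := pair m (pair a (pair b K)).
Notation sEval := (st 0).
Notation sEvals := (st 1).
Notation sRet v K := (st 2 v 0 K).
Notation sStuck := (st 3 0 0 0).

Notation kArg gs xs := (pair 0 (pair gs xs)).
Notation kCons v := (pair 1 v).
Notation kApp f := (pair 2 f).
Notation kPrec g y xs := (pair 3 (pair g (pair y xs))).
Notation kMu f xs y := (pair 4 (pair f (pair xs y))).

(** The tags 0, 4 and 6 accept an empty input and come before the test for it. A projection drops
    one argument per step, and the oracle, being empty, answers 0. *)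
Definition step_eval c xs K :=
  if p1 c == 0 then sRet 0 K
  else if p1 c == 4 then sEvals (p2 (p2 c)) xs (lcons (kApp (p1 (p2 c))) K)
  else if p1 c == 6 then sEval (p2 c) (lcons 0 xs) (lcons (kMu (p2 c) xs 0) K)
  else if xs == 0 then sStuck
  else if p1 c == 1 then sRet (lhd xs).+1 K
  else if p1 c == 2 then
    if p2 c == 0 then sRet (lhd xs) K else sEval (pair 2 (p2 c).-1) (ltl xs) K
  else if p1 c == 3 then sRet 0 K
  else if lhd xs == 0 then sEval (p1 (p2 c)) (ltl xs) K
  else sEval c (lcons (lhd xs).-1 (ltl xs))
         (lcons (kPrec (p2 (p2 c)) (lhd xs).-1 (ltl xs)) K).

Definition step_evals gs xs K :=
  if gs == 0 then sRet 0 K else sEval (lhd gs) xs (lcons (kArg (ltl gs) xs) K).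

Definition step_ret v K0 :=
  let fr := lhd K0 in let K := ltl K0 in let d := p2 fr in
  if K0 == 0 then sRet v 0
  else if p1 fr == 0 then sEvals (p1 d) (p2 d) (lcons (kCons v) K)
  else if p1 fr == 1 then sRet (lcons d v) K
  else if p1 fr == 2 then sEval d v K
  else if p1 fr == 3 then sEval (p1 d) (lcons (p1 (p2 d)) (lcons v (p2 (p2 d)))) K
  else if v == 0 then sRet (p2 (p2 d)) K
  else sEval (p1 d) (lcons (p2 (p2 d)).+1 (p1 (p2 d)))
         (lcons (kMu (p1 d) (p1 (p2 d)) (p2 (p2 d)).+1) K).

Definition step s :=
  let a := p1 (p2 s) in let b := p1 (p2 (p2 s)) in let K := p2 (p2 (p2 s)) in
  if p1 s == 0 then step_eval a b K
  else if p1 s == 1 then step_evals a b K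
  else if p1 s == 2 then step_ret a K
  else s.

Definition final s := (p1 s == 2) && (p2 (p2 (p2 s)) == 0).
Definition halts_in n s := final (iter n step s).

(** A form of Kleene's T predicate in which the number of steps stands for the computation. *)
Definition universal e xs n := halts_in n (sEval e xs 0).

Lemma comp_step O : computable O step.
Proof.
rewrite /step /step_eval /step_evals /step_ret /st /lcons /lhd /ltl.
by cbv zeta; comp_auto.
Qed.

Lemma comp_universal O E X N : computable O E -> computable O X -> computable O N ->
  computable O (fun x => universal (E x) (X x) (N x)).
Proof.
move=> cE cX cN; rewrite /universal /halts_in /final.
have cI : computable O (fun x => iter (N x) step (sEval (E x) (X x) 0)).
  apply: comp_iter => //; first by rewrite /st; comp_auto.
  exact: (comp_comp (comp_step O) (comp_p2 (comp_id O))).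
by comp_auto.
Qed.

Lemma step_st m a b K : step (st m a b K) =
  if m == 0 then step_eval a b K
  else if m == 1 then step_evals a b K
  else if m == 2 then step_ret a K
  else st m a b K.
Proof. by rewrite /step /st !(p1K, p2K). Qed.

Lemma step_arg v gs xs K : step (sRet v (lcons (kArg gs xs) K)) = sEvals gs xs (lcons (kCons v) K).
Proof. by rewrite step_st /step_ret !(lhdK, ltlK, p1K, p2K). Qed.
Lemma step_cons v w K : step (sRet v (lcons (kCons w) K)) = sRet (lcons w v) K.
Proof. by rewrite step_st /step_ret !(lhdK, ltlK, p1K, p2K). Qed.
Lemma step_app v f K : step (sRet v (lcons (kApp f) K)) = sEval f v K.
Proof. by rewrite step_st /step_ret !(lhdK, ltlK, p1K, p2K). Qed.
Lemma step_prec v g y xs K :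
  step (sRet v (lcons (kPrec g y xs) K)) = sEval g (lcons y (lcons v xs)) K.
Proof. by rewrite step_st /step_ret !(lhdK, ltlK, p1K, p2K). Qed.
Lemma step_mu v f xs y K : step (sRet v (lcons (kMu f xs y) K)) =
  if v == 0 then sRet y K else sEval f (lcons y.+1 xs) (lcons (kMu f xs y.+1) K).
Proof. by rewrite step_st /step_ret !(lhdK, ltlK, p1K, p2K). Qed.

Lemma step_nil xs K : step (sEvals 0 xs K) = sRet 0 K.
Proof. by rewrite step_st. Qed.
Lemma step_evcons g gs xs K :
  step (sEvals (lcons g gs) xs K) = sEval g xs (lcons (kArg gs xs) K).
Proof. by rewrite step_st /step_evals !(lhdK, ltlK). Qed.

Lemma step_code c xs K : step (sEval (encc c) (encl xs) K) =
  match c, xs with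
  | cZero, _ => sRet 0 K
  | cComp f gs, _ => sEvals (encl (map encc gs)) (encl xs) (lcons (kApp (encc f)) K)
  | cMu f, _ => sEval (encc f) (encl (0 :: xs)) (lcons (kMu (encc f) (encl xs) 0) K)
  | _, [::] => sStuck
  | cSucc, x :: _ => sRet x.+1 K
  | cProj 0, x :: _ => sRet x K
  | cProj i.+1, _ :: xs => sEval (encc (cProj i)) (encl xs) K
  | cOracle, _ :: _ => sRet 0 K
  | cPrec f _, 0 :: xs => sEval (encc f) (encl xs) K
  | cPrec f g, y.+1 :: xs => sEval (encc (cPrec f g)) (encl (y :: xs))
        (lcons (kPrec (encc g) y (encl xs)) K)
  end.
Proof.
rewrite step_st /= /step_eval.
case: c => [||i||f gs|f g|f] /=; rewrite ?(p1K, p2K) //=; case: xs => [|x xs] //=;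
  rewrite ?(lhdK, ltlK) //; [by case: i | by case: i | by case: x].
Qed.

(** * Correctness of the machine *)

Lemma final_st m a b K : final (st m a b K) = (m == 2) && (K == 0).
Proof. by rewrite /final /st !(p1K, p2K). Qed.

Lemma halts_inS n s : ~~ final s -> halts_in n s -> exists2 n', n = n'.+1 & halts_in n' (step s).
Proof.
case: n => [|n] nf; first by rewrite /halts_in /= (negbTE nf).
by rewrite /halts_in iterSr; exists n.
Qed.

Lemma stuck_halts n : ~ halts_in n sStuck.
Proof.
elim: n => [|n IH]; first by rewrite /halts_in /= final_st.
by rewrite /halts_in iterSr step_st.
Qed.

(** The frame list [K] is arbitrary, so that the run of a subcomputation can be inserted under the
    frames of the caller. *)
Lemma eval_run :
  (forall c xs v, eval empty_oracle c xs v -> forall K,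
     exists n, iter n step (sEval (encc c) (encl xs) K) = sRet v K) /\
  (forall gs xs vs, evals empty_oracle gs xs vs -> forall K,
     exists n, iter n step (sEvals (encl (map encc gs)) (encl xs) K) = sRet (encl vs) K).
Proof.
apply: eval_evals_ind.
- by move=> xs K; exists 1; rewrite /= (step_code cZero).
- by move=> x xs K; exists 1; rewrite /= (step_code cSucc (x :: xs)).
- move=> i xs; elim: i xs => [|i IH] [|x xs] //= lt K.
    by exists 1; rewrite /= (step_code (cProj 0) (x :: xs)).
  have [n E] := IH xs lt K; exists n.+1.
  by rewrite iterSr (step_code (cProj i.+1) (x :: xs)).
- by move=> x xs [].
- by move=> x xs _ K; exists 1; rewrite /= (step_code cOracle (x :: xs)).
- move=> f gs xs ys v IHg IHf K.
  have [n1 E1] := IHg (lcons (kApp (encc f)) K); have [n2 E2] := IHf K.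
  (* The right summand runs first; the two successors count the steps that push and pop the frame
     [kApp]. *)
  exists (n2.+1 + n1.+1); rewrite iterD [iter n1.+1 _ _]iterSr (step_code (cComp f gs)) E1.
  by rewrite iterSr step_app.
- move=> f g xs v IHf K; have [n E] := IHf K.
  by exists n.+1; rewrite iterSr (step_code (cPrec f g) (0 :: xs)).
- move=> f g y xs w v IHw IHv K.
  have [n1 E1] := IHw (lcons (kPrec (encc g) y (encl xs)) K); have [n2 E2] := IHv K.
  exists (n2.+1 + n1.+1).
  rewrite iterD [iter n1.+1 _ _]iterSr (step_code (cPrec f g) (y.+1 :: xs)) E1.
  by rewrite iterSr step_prec.
- move=> f xs y IH0 IHl K.
  (* The search loop reaches every candidate up to [y], since all smaller ones return a nonzero
     value. *)
  have H z : z <= y -> exists n, iter n step (sEval (encc f) (encl (0 :: xs))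
      (lcons (kMu (encc f) (encl xs) 0) K)) =
      sEval (encc f) (encl (z :: xs)) (lcons (kMu (encc f) (encl xs) z) K).
    elim: z => [|z IHz] lez; first by exists 0.
    have [n E] := IHz (ltnW lez); have [w Hw] := IHl z lez.
    have [n1 E1] := Hw (lcons (kMu (encc f) (encl xs) z) K).
    by exists (n1.+1 + n); rewrite iterD E iterS E1 step_mu.
  have [n E] := H y (leqnn y); have [n1 E1] := IH0 (lcons (kMu (encc f) (encl xs) y) K).
  exists (n1.+1 + n).+1; rewrite iterSr (step_code (cMu f)) iterD E iterS E1.
  by rewrite step_mu.
- by move=> xs K; exists 1; rewrite /= step_nil.
- move=> g gs xs v vs IHv IHvs K.
  have [n1 E1] := IHv (lcons (kArg (encl (map encc gs)) (encl xs)) K).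
  have [n2 E2] := IHvs (lcons (kCons v) K).
  exists (n2.+1.+1 + n1.+1); rewrite iterD [iter n1.+1 _ _]iterSr step_evcons E1.
  by rewrite iterSr step_arg iterS E2 step_cons.
Qed.

(** A halting run is cut where the subcomputation returns; the [n'] steps that remain are what the
    induction hypothesis needs for the continuation. The third clause is the invariant of the
    minimization loop. Evaluation is proved first, since that clause uses it at the same [n]. *)
Lemma run_sound n :
  [/\ forall c xs K, halts_in n (sEval (encc c) (encl xs) K) ->
        exists v n', [/\ n' <= n, eval empty_oracle c xs v & halts_in n' (sRet v K)],
      forall gs xs K, halts_in n (sEvals (encl (map encc gs)) (encl xs) K) ->
        exists vs n', [/\ n' <= n, evals empty_oracle gs xs vs & halts_in n' (sRet (encl vs) K)] &
      forall f xs y K, (forall z, z < y -> exists w, eval empty_oracle f (z :: xs) w.+1) ->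
        halts_in n (sEval (encc f) (encl (y :: xs)) (lcons (kMu (encc f) (encl xs) y) K)) ->
        exists v n', [/\ n' < n, eval empty_oracle (cMu f) xs v & halts_in n' (sRet v K)]].
Proof.
elim/ltn_ind: n => n IH; have Hev : forall c xs K, halts_in n (sEval (encc c) (encl xs) K) ->
    exists v n', [/\ n' <= n, eval empty_oracle c xs v & halts_in n' (sRet v K)].
  move=> c xs K /halts_inS; rewrite final_st => /(_ isT) [n1 E].
  rewrite step_code; have [IHe IHs IHm] := IH n1 (eq_leq (esym E)); subst n.
  case: c => [||i||f gs|f g|f].
  - by exists 0, n1; split; rewrite ?leqnSn //; exact: ev_zero.
  - case: xs => [/stuck_halts //|x xs] H.
    by exists x.+1, n1; split; rewrite ?leqnSn //; exact: ev_succ.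
  - case: i xs => [|i] [|x xs] => [/stuck_halts //|H|/stuck_halts //|/IHe].
      by exists x, n1; split; rewrite ?leqnSn //; exact: ev_proj_eq.
    case=> v [n' [le Hv Hn]]; exists v, n'; split; rewrite ?(leqW le) //.
    by inversion Hv; exact: (@ev_proj _ i.+1).
  - case: xs => [/stuck_halts //|x xs] H.
    by exists 0, n1; split; rewrite ?leqnSn //; exact: ev_orac0.
  - case/IHs=> vs [n2 [le2 Hvs /halts_inS]]; rewrite final_st => /(_ isT) [n3 E3].
    rewrite step_app; subst n2; have [IHe3 _ _] := IH n3 (leqW le2).
    case/IHe3=> v [n4 [le4 Hv Hn]]; exists v, n4; split=> //; [lia | exact: ev_comp Hvs Hv].
  - case: xs => [/stuck_halts //|[|y] xs].
      case/IHe=> v [n' [le Hv Hn]]; exists v, n'; split; rewrite ?(leqW le) //.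
      exact: ev_prec0.
    case/(IHe (cPrec f g))=> w [n2 [le2 Hw /halts_inS]]; rewrite final_st => /(_ isT) [n3 E3].
    rewrite step_prec; subst n2; have [IHe3 _ _] := IH n3 (leqW le2).
    case/(IHe3 g (y :: w :: xs))=> v [n4 [le4 Hv Hn]]; exists v, n4.
    by split=> //; [lia | exact: ev_precS Hw Hv].
  - by case/IHm=> // v [n' [le Hv Hn]]; exists v, n'; split=> //; lia.
split=> //.
- move=> gs xs K /halts_inS; rewrite final_st => /(_ isT) [n1 E].
  have [IHe IHs _] := IH n1 (eq_leq (esym E)); subst n.
  case: gs => [|g gs] /=.
    by rewrite step_nil => H; exists [::], n1; split; rewrite ?leqnSn //; exact: evs_nil.
  rewrite step_evcons => /IHe [v [n2 [le2 Hv /halts_inS]]]; rewrite final_st => /(_ isT) [n3 E3].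
  rewrite step_arg; subst n2; have [_ IHs3 _] := IH n3 (leqW le2).
  case/IHs3=> vs [n4 [le4 Hvs /halts_inS]]; rewrite final_st => /(_ isT) [n5 E5].
  rewrite step_cons => H; exists (v :: vs), n5; split=> //; [lia | exact: evs_cons].
- move=> f xs y K Hl /Hev [w [n2 [le2 Hw /halts_inS]]]; rewrite final_st => /(_ isT) [n3 E3].
  rewrite step_mu; subst n2; case: w Hw => [|w] Hw /= H.
    by exists y, n3; split=> //; exact: ev_mu.
  have [_ _ IHm] := IH n3 le2; case/IHm: H => [z|].
    rewrite ltnS leq_eqVlt => /orP[/eqP->|]; [by exists w | exact: Hl].
  by move=> v [n' [lt Hv Hn]]; exists v, n'; split=> //; lia.
Qed.

Theorem universalP c xs :
  halts empty_oracle c xs <-> exists n, universal (encc c) (encl xs) n.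
Proof.
split=> [[v /(proj1 eval_run)/(_ 0) [n E]]|[n H]].
  by exists n; rewrite /universal /halts_in E final_st.
have [Hev _ _] := run_sound n.
by have [v [_ [_ Hv _]]] := Hev _ _ _ H; exists v.
Qed.

(** * A generic set with a computable approximation *)

Lemma bitS x n : bit x.+1 n = bit x n./2.
Proof. by rewrite /bit iterSr. Qed.

Lemma bit_ltn x n : bit x n -> x < n.
Proof.
elim: x n => [|x IH] n; first by case: n.
by rewrite bitS => /IH; lia.
Qed.

Lemma bit_inj n n' : bit^~ n =1 bit^~ n' -> n = n'.
Proof.
elim/ltn_ind: {n n'}(n + n') {-2}n {-2}n' (erefl (n + n')) => s IH n n' E H.
have H0 := H 0; rewrite /bit /= in H0.
case: (posnP s) => [s0|s0]; first by lia.
suff: n./2 = n'./2 by lia.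
by apply: (IH (n./2 + n'./2)) => //; [lia | move=> x; rewrite -!bitS].
Qed.

(** Without repetitions the sum is a binary expansion: its last digit tells whether 0 occurs, and
    its half codes the positive elements shifted down by one. *)
Lemma sum_bits_half L : uniq L -> \sum_(y <- L) 2 ^ y =
  (0 \in L) + (\sum_(y <- [seq y.-1 | y <- L & 0 < y]) 2 ^ y).*2.
Proof.
elim: L => [|[|y] L IH] /=; first by rewrite !big_nil.
  by case/andP=> nL uL; rewrite big_cons IH // (negbTE nL). 
case/andP=> nL uL; rewrite !big_cons IH // in_cons expnS /=; lia.
Qed.

Lemma bit_sum x L : uniq L -> bit x (\sum_(y <- L) 2 ^ y) = (x \in L).
Proof.
elim: x L => [|x IH] L uL.
  by rewrite sum_bits_half // /bit /= oddD odd_double addbF; case: (0 \in L).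
rewrite bitS sum_bits_half // half_bit_double IH.
  apply/mapP/idP => [[[|y]]|xL]; rewrite ?mem_filter //.
    by move=> /andP[_ yL] ->.
  by exists x.+1 => //; rewrite mem_filter.
rewrite map_inj_in_uniq ?filter_uniq // => -[|a] [|b]; rewrite ?mem_filter //.
by move=> _ _ /= ->.
Qed.

(** This supplies the second component of a condition with prescribed values. *)
Lemma bits_comprehension (P : pred nat) n : exists N, forall x, bit x N = (x < n) && P x.
Proof.
exists (\sum_(y <- [seq x <- iota 0 n | P x]) 2 ^ y) => x.
by rewrite bit_sum ?filter_uniq ?iota_uniq // mem_filter mem_iota andbC.
Qed.

Lemma enc_inj : injective enc.
Proof.
elim=> [|b s IH] [|b' s'] //=; [by case: b'; lia | by case: b; lia |].
move=> E; have [e1 e2] : b = b' /\ enc s = enc s' by case: b b' E => -[]; lia.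
by rewrite e1 (IH _ e2).
Qed.

Lemma enc_surj n : exists s, enc s = n.
Proof.
elim/ltn_ind: n => -[|n] IH; first by exists [::].
have [s E] : exists s, enc s = n./2 by apply: IH; lia.
by exists (odd n :: s); rewrite /= E; have := odd_double_half n; case: odd; lia.
Qed.

Lemma leq_size_enc s : size s <= enc s.
Proof. by elim: s => //= b s; case: b; lia. Qed.

Lemma bit_setcode t B : bit (enc t) (setcode B) = (t \in B).
Proof.
rewrite /setcode -(big_map enc xpredT (fun y => 2 ^ y)) bit_sum.
  by rewrite (mem_map enc_inj) mem_undup.
by rewrite (map_inj_uniq enc_inj) undup_uniq.
Qed.

(** Any number found by a search can thus be read back as a finite set of strings. *)
Lemma setcode_surj N : exists B, setcode B = N.
Proof.
have [B E] : exists B, map enc B = [seq x <- iota 0 N | bit x N].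
  elim: [seq x <- _ | _] => [|x L [B <-]]; first by exists [::].
  by have [s <-] := enc_surj x; exists (s :: B).
exists B; apply: bit_inj => x; have [s <-] := enc_surj x.
rewrite bit_setcode -(mem_map enc_inj) E mem_filter mem_iota /= add0n.
by case b : bit => //=; exact: bit_ltn.
Qed.

(** In bijective base 2 the code of [b :: s'] is odd exactly when [b] is false, and halving its
    predecessor gives the code of [s']. *)
Fixpoint prefix_enc (s : str) (n : nat) : bool :=
  if s is b :: s' then [&& 0 < n, odd n == ~~ b & prefix_enc s' n.-1./2] else true.

Lemma prefix_encE s t : prefix_enc s (enc t) = prefix s t.
Proof.
elim: s t => [|b s IH] [|c t] //=; rewrite -IH.
have [-> ->] : odd ((enc t).*2 + (if c then 2 else 1)) = ~~ c /\
  ((enc t).*2 + (if c then 2 else 1)).-1./2 = enc t by case: c; lia.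
have -> : 0 < (enc t).*2 + (if c then 2 else 1) by case: c; lia.
by case: b c => -[].
Qed.

Lemma comp_prefix_enc O s F : computable O F -> computable O (fun x => prefix_enc s (F x)).
Proof.
elim: s F => [|b s IH] F cF /=; first exact: comp_const.
have H : computable O (fun x => prefix_enc s (F x).-1./2) by apply: IH; comp_auto.
by comp_auto.
Qed.

(* A condition [pair l N] fixes the first [l] values of a set to be the bits of [N]. *)
Definition extends q q' :=
  (p1 q <= p1 q') && all (fun x => bit x (p2 q) == bit x (p2 q')) (iota 0 (p1 q)).

Lemma extendsP q q' : reflect
  (p1 q <= p1 q' /\ forall x, x < p1 q -> bit x (p2 q) = bit x (p2 q')) (extends q q').
Proof.
apply: (iffP andP) => -[le H]; split=> //.
  by move=> x lt; apply/eqP; apply: (allP H); rewrite mem_iota.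
by apply/allP => x; rewrite mem_iota => /H ->.
Qed.

(* [w] codes an input list (with a condition in front) and a number of steps. *)
Definition meets e q w :=
  [&& p1 w != 0, universal e (p1 w) (p2 w) & extends q (lhd (p1 w))].

(** [find] returns [s] when it fails, so [w < s] means success. In both cases the length grows by at
    least one, so that every value is eventually fixed. *)
Definition next s e q :=
  let w := find (meets e q) (iota 0 s) in
  let q' := if w < s then lhd (p1 w) else q in pair (p1 q').+1 (p2 q').

Definition approx s n := iteri n (next s) (pair 0 0).

(** After [x.+1] steps the condition has length greater than [x], so its digit at [x] is never
    revised by later steps of the same stage. *)
Definition generic_approx x s := bit x (p2 (approx s x.+1)).

Lemma comp_generic_approx O : computable2 O (fun x s => generic_approx x s).
Proof.
have cm : computable2 O (fun p w => meets (p1 p) (p2 p) w).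
  have cu : computable2 O (fun p w => universal (p1 p) (p1 w) (p2 w)).
    by rewrite /computable2; apply: comp_universal; comp_auto.
  by rewrite /meets /extends /lhd /computable2; comp_auto.
(* The bounded search has one parameter, so the index [e] and the condition [q] are packed
   together. *)
have cf : computable2 O (fun p s => find (meets (p1 p) (p2 p)) (iota 0 s)).
  apply: comp_find; last by comp_auto.
  have H := @comp_comp2 O _ (fun p => p1 (p1 p)) p2 cm.
  by apply: H; [comp_auto | exact: (comp_p2 (comp_id O))].
have cF F G H : computable O F -> computable O G -> computable O H ->
    computable O (fun p => find (meets (F p) (G p)) (iota 0 (H p))).
  move=> hF hG hH; apply: comp_ext (comp_comp2 cf (comp_pair hF hG) hH) => x.
  by rewrite p1K p2K.
have cn F G H : computable O F -> computable O G -> computable O H ->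
    computable O (fun p => next (F p) (G p) (H p)).
  move=> hF hG hH; have h := cF _ _ _ hG hH hF.
  by rewrite /next /lhd; cbv zeta; comp_auto.
have ca : computable2 O (fun x s => approx s x.+1).
  rewrite /approx /computable2; apply: comp_iteri; [by comp_auto | by comp_auto |].
  by apply: cn; comp_auto.
by rewrite /generic_approx /computable2 in ca *; comp_auto.
Qed.

(** * Convergence and genericity of the approximation *)

Lemma extends_refl q : extends q q.
Proof. by apply/extendsP. Qed.

Lemma extends_trans q q' q'' : extends q q' -> extends q' q'' -> extends q q''.
Proof.
move=> /extendsP[l1 H1] /extendsP[l2 H2]; apply/extendsP; split; first exact: leq_trans l2.
by move=> x lt; rewrite H1 // H2 // (leq_trans lt).
Qed.

Lemma extends_next s e q : extends q (next s e q).
Proof.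
rewrite /next; set w := find _ _; case: ltnP => [lt|_]; last first.
  by apply/extendsP; rewrite p1K p2K.
have: meets e q w.
  have := nth_find 0 (a := meets e q) (s := iota 0 s).
  by rewrite has_find size_iota -/w => /(_ lt); rewrite nth_iota.
case/and3P=> _ _ /extendsP[le H].
by apply/extendsP; rewrite p1K p2K; split=> //; exact: leqW.
Qed.

Lemma approx_extends s n m : n <= m -> extends (approx s n) (approx s m).
Proof.
move=> /subnK <-; elim: (m - n) => [|d IH]; first exact: extends_refl.
by rewrite addSn; apply: extends_trans IH (extends_next _ _ _).
Qed.

Lemma leq_approx s n : n <= p1 (approx s n).
Proof.
elim: n => // n IH; rewrite [approx _ _]/= -/(approx s n).
rewrite /next; set w := find _ _; rewrite p1K ltnS.
case: ltnP => // lt; apply: leq_trans IH _.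
have: meets n (approx s n) w.
  have := nth_find 0 (a := meets n (approx s n)) (s := iota 0 s).
  by rewrite has_find size_iota -/w => /(_ lt); rewrite nth_iota.
by case/and3P=> _ _ /extendsP[].
Qed.

Lemma find_iota (P : pred nat) w s : P w -> (forall v, P v -> w <= v) -> w < s ->
  find P (iota 0 s) = w.
Proof.
move=> Pw Hw lt.
have hs : has P (iota 0 s) by apply/hasP; exists w => //; rewrite mem_iota.
have ltf : find P (iota 0 s) < s by move: hs; rewrite has_find size_iota.
apply/eqP; rewrite eqn_leq; apply/andP; split; last first.
  by apply: Hw; have := nth_find 0 hs; rewrite nth_iota.
rewrite leqNgt; apply/negP => /(before_find 0).
by rewrite nth_iota // add0n Pw.
Qed.

(** Once [s] exceeds the least witness, the search always returns that witness; if there is none, it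
    fails at every stage. The case distinction is classical. *)
Lemma next_stable e q : exists q' s0, (forall s, s0 <= s -> next s e q = q') /\
  ((exists w, meets e q w) -> exists2 w, meets e q w &
     q' = pair (p1 (lhd (p1 w))).+1 (p2 (lhd (p1 w)))).

Proof.
case: (classic (exists w, meets e q w)) => [H|H].
  have [w mw Hw] := ex_minnP H.
  exists (pair (p1 (lhd (p1 w))).+1 (p2 (lhd (p1 w)))), w.+1; split; last by exists w.
  by move=> s lt; rewrite /next (find_iota mw Hw lt) lt.
exists (pair (p1 q).+1 (p2 q)), 0; split=> // s _.
rewrite /next hasNfind ?size_iota ?ltnn //.
by apply/hasPn => w _; apply/negP => mw; apply: H; exists w.
Qed.

(** When the first [n] steps have settled, the next one acts on a fixed condition and settles
    too. *)
Lemma approx_stable n : exists q s0, forall s, s0 <= s -> approx s n = q.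
Proof.
elim: n => [|n [q [s0 H]]]; first by exists (pair 0 0), 0.
have [q' [s1 [H1 _]]] := next_stable n q.
exists q', (maxn s0 s1) => s; rewrite geq_max => /andP[l0 l1].
by rewrite [approx _ _]/= -/(approx s n) H // H1.
Qed.

Lemma generic_approx_cvg x : exists b s0, forall s, s0 <= s -> generic_approx x s = b.
Proof.
have [q [s0 H]] := approx_stable x.+1.
by exists (bit x (p2 q)), s0 => s /H; rewrite /generic_approx => ->.
Qed.

(** The step with index [encc c] eventually starts from a fixed condition; density provides a
    witness above it, the least one is adopted, and all later steps extend it. The list [xs] carries
    the data found along with the condition. *)
Lemma generic_approx_meets c :
  (forall l N, exists xs l' N', [/\ halts empty_oracle c (pair l' N' :: xs), l <= l' &
     forall x, x < l -> bit x N = bit x N']) ->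
  exists xs l N s0, halts empty_oracle c (pair l N :: xs) /\
    forall s, s0 <= s -> forall x, x < l -> generic_approx x s = bit x N.
Proof.
move=> dense; set e := encc c; have [q [s0 Hq]] := approx_stable e.
have [q' [s1 [H1 Hq']]] := next_stable e q.
have [|w /and3P[nz Uw _] E] := Hq'.
  have [xs [l [N [/universalP [n Hn] le H]]]] := dense (p1 q) (p2 q).
  exists (pair (encl (pair l N :: xs)) n); rewrite /meets p1K p2K Hn /= lhdK.
  by apply/extendsP; rewrite p1K p2K.
have [[|y xs] Exs] := encl_surj (p1 w); first by rewrite -Exs in nz.
exists xs, (p1 y), (p2 y), (maxn s0 s1); split.
  by apply/universalP; exists (p2 w); rewrite pairK Exs.
move=> s; rewrite geq_max => /andP[l0 l1] x lt.
have Ee : approx s e.+1 = pair (p1 y).+1 (p2 y).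
  by rewrite [approx _ _]/= -/(approx s e) Hq // H1 // E -Exs /= lhdK.
(* The value at [x] is read after [x.+1] steps, and the witness is adopted after [e.+1]. One of the
   two conditions extends the other, and both fix the value at [x]. *)
rewrite /generic_approx; case: (leqP x e) => le.
  have /extendsP[_ H] := @approx_extends s x.+1 e.+1 le.
  by rewrite H ?leq_approx // Ee p2K.
have /extendsP[_ H] := @approx_extends s e.+1 x.+1 (leqW le).
by rewrite -H Ee ?p1K ?p2K // leqW.
Qed.

(** * Choosing incomparable strings *)

Lemma incomparable_sym : symmetric incomparable.
Proof. by move=> s t; rewrite /incomparable andbC. Qed.

Lemma prefix_total (s s' t : str) : prefix s t -> prefix s' t -> prefix s s' || prefix s' s.
Proof.
wlog le : s s' / size s <= size s' => [H ps ps'|].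
  by case: (leqP (size s) (size s')) => [/H|/ltnW/H]; [apply | rewrite orbC; apply].
by rewrite !prefixE => /eqP Es /eqP Es'; rewrite -{1}Es' take_takel ?Es ?eqxx.
Qed.

Lemma incomparable_prefix (s s' t : str) : prefix s t -> prefix s' t -> incomparable s s' = false.
Proof. by move=> ps ps'; rewrite /incomparable -negb_or (prefix_total ps ps'). Qed.

(** A string no longer than [z] and comparable with it is a prefix of [z], and two prefixes of one
    string are comparable. *)
Lemma count_comparable (z : str) r : all (fun y => size y <= size z) r -> pairwise incomparable r ->
  count (predC (incomparable z)) r <= 1.
Proof.
move=> le pr; have pre y : y \in r -> ~~ incomparable z y -> prefix y z.
  move=> /(allP le) ly; rewrite /incomparable -negb_or negbK => /orP[pzy|//].
  have /eqP E := prefixE z y; move: pzy; rewrite prefixE take_oversize // => /eqP ->.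
  exact: prefix_refl.
elim: r {le} pr pre => //= y r IH /andP[py pr] pre.
case: (boolP (incomparable z y)) => [_|ny] /=.
  by apply: IH => // w wr; apply: pre; rewrite in_cons wr orbT.
rewrite (eqP (_ : count _ r == 0)) // -leqn0 leqNgt -has_count; apply/hasPn => w wr /=.
rewrite negbK; apply/negPn/negP => nw; move: (allP py _ wr).
rewrite (@incomparable_prefix _ _ z) //; apply: pre => //; first exact: mem_head.
by rewrite in_cons wr orbT.
Qed.

Lemma seq_argmax (T : eqType) (f : T -> nat) x s :
  exists2 y, y \in x :: s & forall z, z \in x :: s -> f z <= f y.
Proof.
elim: s x => [|x' s IH] x; first by exists x => [|z]; rewrite inE // => /eqP->.
have [y ys H] := IH x'; case: (leqP (f x) (f y)) => le.
  exists y => [|z]; first by rewrite in_cons ys orbT.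
  by rewrite in_cons => /orP[/eqP->|/H].
exists x => [|z]; first exact: mem_head.
by rewrite in_cons => /orP[/eqP->//|/H lz]; exact: leq_trans (ltnW le).
Qed.

(* Pick a longest string of all: every other row contains at most one string
   comparable with it, since such strings are its prefixes. *)
Lemma incomparable_choice (I : seq nat) (rows : nat -> seq str) :
  uniq I -> (forall i, i \in I -> size I <= size (rows i)) ->
  (forall i, i \in I -> pairwise incomparable (rows i)) ->
  exists ch : nat -> str, (forall i, i \in I -> ch i \in rows i) /\
    forall i j, i \in I -> j \in I -> i != j -> incomparable (ch i) (ch j).
Proof.
elim: {I}(size I) {-2}I (erefl (size I)) rows => [|n IH] I sI rows uI szr pr.
  by move/size0nil: sI => ->; exists (fun=> [::]).
(* Each string is tagged with its row, so that a longest string comes with the row it is chosen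
   for. *)
pose s := flatten [seq [seq (i, y) | y <- rows i] | i <- I].
have sP p : (p \in s) = (p.1 \in I) && (p.2 \in rows p.1).
  apply/flatten_mapP/andP => [[i iI /mapP[y yr ->]]//|[iI yr]].
  by exists p.1 => //; apply/mapP; exists p.2 => //; case: (p).
have [[i0 z] zs zmax] : exists2 p, p \in s & forall q, q \in s -> size q.2 <= size p.2.
  case E: s => [|p s']; last exact: (seq_argmax (fun q : nat * str => size q.2)).
  case: I sI {uI pr} szr s sP E => // i I sI szr s sP E.
  have := szr i (mem_head _ _); case R: (rows i) => [|y r] // _.
  by have := sP (i, y); rewrite E /= mem_head R mem_head.
move: zs; rewrite sP /= => /andP[i0I zr].
have zmax' i y : i \in I -> y \in rows i -> size y <= size z.
  by move=> iI yr; apply: (zmax (i, y)); rewrite sP /= iI.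
have memI i : i \in rem i0 I = (i != i0) && (i \in I) by rewrite rem_filter // mem_filter.
(* Removing row [i0] lowers the required size by one, and filtering by [z] costs each other row at
   most one string. *)
have [||i|i|ch [chr chi]] := IH (rem i0 I) _ (fun i => filter (incomparable z) (rows i)).
- by rewrite size_rem // sI.
- exact: rem_uniq.
- rewrite memI => /andP[_ iI]; rewrite size_rem // sI size_filter /=.
  have := szr i iI; rewrite -(count_predC (incomparable z) (rows i)) sI.
  have := @count_comparable z (rows i) _ (pr i iI).
  have -> : all (fun y => size y <= size z) (rows i) by apply/allP => y; exact: zmax'.
  by move=> /(_ isT); lia.
- rewrite memI => /andP[_ iI]; apply: subseq_pairwise (pr i iI).
  exact: filter_subseq.
exists (fun i => if i == i0 then z else ch i); split=> [i iI|i j iI jI ne].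
  case: eqVneq => [->//|ni]; have := chr i; rewrite memI ni iI mem_filter => /(_ isT).
  by case/andP.
have zi k : k \in I -> k != i0 -> incomparable z (ch k).
  by move=> kI nk; have := chr k; rewrite memI nk kI mem_filter => /(_ isT)/andP[].
case: eqVneq => [ei|ni]; case: eqVneq => [ej|nj].
- by rewrite ei ej eqxx in ne.
- exact: zi.
- by rewrite incomparable_sym; exact: zi.
- by apply: chi => //; rewrite memI ?ni ?nj ?iI ?jI.
Qed.

(** * Semidecidable predicates *)

Section Semidecidable.
Variable O : nat -> Prop.

Lemma code2 F : computable2 O F -> exists c, forall x y, eval O c [:: x; y] (F x y).
Proof.
move=> [c Hc]; have [pr Hpr] := pair_code O; exists (cComp c [:: pr]) => x y.
by apply: ev_comp1 (Hpr x y) _; have := Hc (pair x y); rewrite p1K p2K.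
Qed.

Lemma code3 (F : nat -> nat -> nat -> nat) :
  computable O (fun p => F (p1 p) (p1 (p2 p)) (p2 (p2 p))) ->
  exists c, forall x y z, eval O c [:: x; y; z] (F x y z).
Proof.
move=> [c Hc]; have [pr Hpr] := pair_code O.
exists (cComp c [:: cComp pr [:: cProj 0; cComp pr [:: cProj 1; cProj 2]]]) => x y z.
have := Hc (pair x (pair y z)); rewrite !(p1K, p2K); apply: ev_comp1.
apply: ev_comp2 (Hpr _ _); first exact: ev_proj_eq.
by apply: ev_comp2 (Hpr _ _); exact: ev_proj_eq.
Qed.

Lemma evals_fun gs xs vs vs' : evals O gs xs vs -> evals O gs xs vs' -> vs = vs'.
Proof. by move=> H; exact: (proj2 (eval_evals_fun O) _ _ _ H). Qed.

Lemma halts_comp f gs xs : halts O (cComp f gs) xs <-> exists2 ys, evals O gs xs ys & halts O f ys.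
Proof.
split=> [[v H]|[ys Hys [v Hv]]]; last by exists v; exact: ev_comp Hys Hv.
by inversion H as [| | | | |? ? ? ys ? Hg Hf| | |]; subst; exists ys => //; exists v.
Qed.

Lemma evals_proj idx xs ys : evals O (map cProj idx) xs ys <->
  all (fun i => i < size xs) idx /\ ys = map (nth 0 xs) idx.
Proof.
elim: idx ys => [|i idx IH] ys /=.
  by split=> [H|[_ ->]]; [inversion H | exact: evs_nil].
split=> [H|[/andP[lt H] ->]]; last by apply: evs_cons (ev_proj _ lt) _; apply/IH.
inversion H as [|? ? ? v vs Hv Hvs]; subst; move/IH: Hvs => [-> ->].
by inversion Hv as [| |? ? lt| | | | | |]; subst; rewrite lt.
Qed.

(** The inputs are lists of any length. A projection halts only when its index is in range, hence
    the size bounds in the predicates below. *)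
Definition semidecidable (D : seq nat -> Prop) := exists c, forall xs, halts O c xs <-> D xs.

Lemma semidecidable_and D E : semidecidable D -> semidecidable E ->
  semidecidable (fun xs => D xs /\ E xs).
Proof.
move=> [c Hc] [d Hd]; exists (cComp cZero [:: c; d]) => xs; rewrite halts_comp -Hc -Hd.
split=> [[ys H _]|[[v Hv] [w Hw]]].
  inversion H as [|? ? ? v vs Hv Hvs]; subst; split; first by exists v.
  by inversion Hvs as [|? ? ? w ? Hw]; subst; exists w.
exists [:: v; w]; last by exists 0; exact: ev_zero.
by apply: evs_cons Hv _; apply: evs_cons Hw _; exact: evs_nil.
Qed.

Lemma semidecidable_all (T : eqType) (s : seq T) (D : T -> seq nat -> Prop) :
  (forall t, semidecidable (D t)) -> semidecidable (fun xs => forall t, t \in s -> D t xs).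
Proof.
move=> H; elim: s => [|t s IH].
  by exists cZero => xs; split=> // _; exists 0; exact: ev_zero.
have [c Hc] := semidecidable_and (H t) IH; exists c => xs; rewrite Hc.
split=> [[Ht Hs] u|Hts]; first by rewrite in_cons => /orP[/eqP->|/Hs].
by split=> [|u us]; apply: Hts; rewrite in_cons ?eqxx ?us ?orbT.
Qed.

Lemma semidecidable_select c idx :
  semidecidable (fun xs => all (fun i => i < size xs) idx /\ halts O c (map (nth 0 xs) idx)).
Proof.
exists (cComp c (map cProj idx)) => xs; rewrite halts_comp.
split=> [[ys /evals_proj[H ->]]|[H Hc]] //.
by exists (map (nth 0 xs) idx) => //; apply/evals_proj.
Qed.

(** [cMu] looks for a zero, so it is applied to the negation of [P]. *)
Lemma search_code (P : nat -> nat -> bool) : computable2 O (fun x u => P x u) ->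
  exists c, forall u, halts O c [:: u] <-> exists x, P x u.
Proof.
move=> cP; have [c Hc] := @code2 (fun x u => ~~ P x u) (comp_neg cP).
exists (cMu c) => u; split=> [[x H]|ex].
  inversion H as [| | | | | | | |? ? ? H0]; subst; exists x.
  by have := eval_fun H0 (Hc x u); case: (P x u).
have [x Px Hx] := ex_minnP ex; exists x; apply: ev_mu.
  by have := Hc x u; rewrite Px.
move=> z lt; exists 0; have := Hc z u; case Pz: (P z u) => //.
by have := Hx _ Pz; rewrite leqNgt lt.
Qed.

(** A total test becomes a halting condition through an unbounded search over a dummy variable. *)
Lemma test_code (P : nat -> nat -> bool) : computable2 O (fun x y => P x y) ->
  exists c, forall x y, halts O c [:: x; y] <-> P x y.
Proof.
move=> cP; have [|c Hc] := @search_code (fun _ p => P (p1 p) (p2 p)).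
  by rewrite /computable2; exact: (comp_comp cP (comp_p2 (comp_id O))).
have [pr Hpr] := pair_code O; exists (cComp c [:: pr]) => x y; rewrite halts_comp.
have Hp : evals O [:: pr] [:: x; y] [:: pair x y].
  by apply: evs_cons (Hpr x y) _; exact: evs_nil.
split=> [[ys /evals_fun/(_ Hp) -> /Hc[_]]|Pxy]; first by rewrite p1K p2K.
by exists [:: pair x y] => //; apply/Hc; exists 0; rewrite p1K p2K.
Qed.

Lemma semidecidable_test (P : nat -> nat -> bool) i j : computable2 O (fun x y => P x y) ->
  semidecidable (fun xs => [/\ i < size xs, j < size xs & P (nth 0 xs i) (nth 0 xs j)]).
Proof.
move=> /test_code[c Hc]; have [d Hd] := semidecidable_select c [:: i; j].
exists d => xs; rewrite Hd /= Hc andbT.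
by split=> [[/andP[]]|[-> ->]].
Qed.

End Semidecidable.

(** * Fairness *)

Definition generic_set (s : str) : Prop := exists s0, forall t, s0 <= t -> generic_approx (enc s) t.
Definition generic_compl (s : str) : Prop := ~ generic_set s.

Lemma generic_set_cvg s b s0 :
  (forall t, s0 <= t -> generic_approx (enc s) t = b) -> generic_set s <-> b.
Proof.
move=> H; split=> [[s1 H1]|hb]; last by exists s0 => t /H ->.
by rewrite -(H (maxn s0 s1)) ?H1 ?leq_maxl ?leq_maxr.
Qed.

(** Since the approximation converges, membership and non-membership both say that from some stage
    [a] on it is constant; writing stages as [a + t] removes the bound on the inner quantifier. *)
Lemma Delta2_generic_set : Delta2_str generic_set.
Proof.
have Sg (b : bool) : Sigma2_str (fun s => exists a, forall t, generic_approx (enc s) (a + t) = b).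
  have [|c Hc] := @code3 empty_oracle (fun x a t => generic_approx x (a + t) == b).
    have cg := @comp_comp2 empty_oracle _ p1 (fun p => p1 (p2 p) + p2 (p2 p))
      (comp_generic_approx empty_oracle).
    have {}cg : computable empty_oracle (fun p => generic_approx (p1 p) (p1 (p2 p) + p2 (p2 p))).
      by apply: cg; comp_auto.
    by comp_auto.
  exists c; split=> [x a t|s]; first by eexists; exact: Hc.
  split=> -[a Ha]; exists a => t.
    by have := Hc (enc s) a t; rewrite Ha eqxx.
  by move: (eval_fun (Ha t) (Hc (enc s) a t)); case: eqP.
have E s (b : bool) : (exists a, forall t, generic_approx (enc s) (a + t) = b) <->
    (if b then generic_set s else ~ generic_set s).
  have [b' [s0 H]] := generic_approx_cvg (enc s); have G := generic_set_cvg H.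
  split=> [[a Ha]|Hb].
    have {Ha} <- : b' = b by rewrite -(Ha s0) H // leq_addl.
    by case: b' G {H} => G; [apply/G | move/G].
  exists s0 => t; rewrite H ?leq_addr //.
  by case: b Hb => [/G|]; case: b' G {H} => // G []; apply/G.
have ext P Q : (forall s, P s <-> Q s) -> Sigma2_str P -> Sigma2_str Q.
  by move=> PQ [c [Hc H]]; exists c; split=> // s; rewrite -PQ.
by split; [apply: ext (Sg true) | apply: ext (Sg false)] => s; exact: (E s _).
Qed.

Lemma computable_generic_coloring :
  computable_coloring (fun s t => generic_approx (enc s) (enc t)).
Proof.
by have [c Hc] := code2 (comp_generic_approx empty_oracle); exists c => s t; exact: Hc.
Qed.

Lemma pairwise_row m k M i : disjoint_matrix m k M -> i < m ->
  pairwise incomparable [seq M i j | j <- iota 0 k].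
Proof.
move=> dM lt; rewrite pairwise_map.
have := iota_uniq 0 k; rewrite uniq_pairwise.
apply: (sub_in_pairwise (P := mem (iota 0 k))); last exact/allP.
by move=> a b; rewrite  !mem_iota => la lb; exact: dM.
Qed.

(** Every row is listed twice, at the indices [i.*2] and [i.*2.+1]. A choice from these [2 * m] rows
    of [2 * m] strings yields a left and a right column in each row. *)
Lemma incomparable_columns m M : disjoint_matrix m (2 * m) M ->
  exists L R : nat -> nat, forall i, i < m -> [/\ L i < 2 * m, R i < 2 * m &
    forall i', i' < m -> incomparable (M i (L i)) (M i' (R i'))].
Proof.
move=> dM; pose rows i := [seq M i./2 j | j <- iota 0 (2 * m)].
have lt2 i : i \in iota 0 (2 * m) -> i./2 < m by rewrite mem_iota; lia.
have [||i /lt2|ch [chr chi]] := @incomparable_choice (iota 0 (2 * m)) rows.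
- exact: iota_uniq.
- by move=> i _; rewrite size_map !size_iota.
- exact: pairwise_row dM.
pose C i := index (ch i) (rows i).
have HC i : i < 2 * m -> C i < 2 * m /\ M i./2 (C i) = ch i.
  move=> lt; have cr : ch i \in rows i by apply: chr; rewrite mem_iota.
  have lC : C i < 2 * m.
    by have := cr; rewrite -index_mem size_map size_iota.
  split=> //; rewrite -(nth_index [::] cr) (nth_map 0) ?size_iota //.
  by rewrite nth_iota.
exists (fun i => C i.*2), (fun i => C i.*2.+1) => i lt.
have [l0 E0] := HC i.*2 ltac:(lia); have [l1 _] := HC i.*2.+1 ltac:(lia); split=> // i' lt'.
have [_ E1] := HC i'.*2.+1 ltac:(lia).
have e0 : i.*2./2 = i by lia.
have e1 : i'.*2.+1./2 = i' by lia.
rewrite e0 in E0; rewrite e1 in E1; rewrite E0 E1; apply: chi; rewrite ?mem_iota; lia.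
Qed.

(* Position of the entry (i, j) in an input list whose head is a condition. *)
Definition entry k i j := (i * k + j).+1.
Definition entries m k := flatten [seq [seq entry k i j | j <- iota 0 k] | i <- iota 0 m].

Lemma map_entries m k (V : valuation) xs :
  (forall i j, i < m -> j < k -> setcode (V i j) = nth 0 xs (entry k i j)) ->
  map (nth 0 xs) (entries m k) = valcode m k V.
Proof.
move=> H; rewrite map_flatten -map_comp; congr flatten.
apply/eq_in_map => i; rewrite mem_iota => li /=; rewrite -map_comp.
by apply/eq_in_map => j; rewrite mem_iota => lj /=; rewrite H.
Qed.

Lemma entry_ltn m k i j : i < m -> j < k -> entry k i j < (m * k).+1.
Proof. by rewrite /entry => li lj; nia. Qed.

(** * Semidecidable tests on a condition and a coded valuation *)

Section Tests.
Variables (m k : nat) (M : matrix) (L R : nat -> nat).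

(** Elements of the set coded by [u] are less than [u], so the scan up to [u] sees all of them. *)
Definition in_cone i j (_ u : nat) :=
  all (fun x => bit x u ==> prefix_enc (M i j) x) (iota 0 u).
Definition forced_in q u :=
  all (fun x => bit x u ==> ((x < p1 q) && bit x (p2 q))) (iota 0 u).
Definition forced_out q u :=
  all (fun x => bit x u ==> ((x < p1 q) && ~~ bit x (p2 q))) (iota 0 u).

Lemma comp_in_cone O i j : computable2 O (fun q u => in_cone i j q u).
Proof.
apply: (@comp_all O (fun p x => bit x (p2 p) ==> prefix_enc (M i j) x)); last by comp_auto.
rewrite /computable2; apply: comp_imp; first by comp_auto.
by apply: comp_prefix_enc; comp_auto.
Qed.
Lemma comp_forced_in O : computable2 O (fun q u => forced_in q u).
Proof. by rewrite /forced_in; comp_auto. Qed.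
Lemma comp_forced_out O : computable2 O (fun q u => forced_out q u).
Proof. by rewrite /forced_out; comp_auto. Qed.

Lemma all_setcodeP (P : pred nat) B :
  reflect (forall t, t \in B -> P (enc t))
    (all (fun x => bit x (setcode B) ==> P x) (iota 0 (setcode B))).
Proof.
apply: (iffP allP) => H.
  move=> t tB; have b : bit (enc t) (setcode B) by rewrite bit_setcode.
  by have := H (enc t); rewrite b mem_iota (bit_ltn b) => /(_ isT).
move=> x _; have [t <-] := enc_surj x; apply/implyP; rewrite bit_setcode; exact: H.
Qed.

Lemma in_coneP i j q B :
  reflect (forall t, t \in B -> prefix (M i j) t) (in_cone i j q (setcode B)).
Proof. by apply: (iffP (all_setcodeP _ _)) => H t /H; rewrite prefix_encE. Qed.

(** The tail of [xs] codes a valuation of [M], and the condition at its head puts the left component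
    of each row into the set and keeps the right one out. The nested conjunctions follow the lemmas
    that prove semidecidability. *)
Definition forces (xs : seq nat) : Prop := forall i, i \in iota 0 m ->
  (forall j, j \in iota 0 k -> [/\ 0 < size xs, entry k i j < size xs &
     in_cone i j (nth 0 xs 0) (nth 0 xs (entry k i j))]) /\
  ([/\ 0 < size xs, entry k i (L i) < size xs &
     forced_in (nth 0 xs 0) (nth 0 xs (entry k i (L i)))] /\
  [/\ 0 < size xs, entry k i (R i) < size xs &
     forced_out (nth 0 xs 0) (nth 0 xs (entry k i (R i)))]).

Lemma semidecidable_forces O : semidecidable O forces.
Proof.
apply: semidecidable_all => i; apply: semidecidable_and.
  by apply: semidecidable_all => j; apply: semidecidable_test; exact: comp_in_cone.
by apply: semidecidable_and; apply: semidecidable_test;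
  [exact: comp_forced_in | exact: comp_forced_out].
Qed.

End Tests.

Lemma one_fair_generic : n_fair 1 empty_oracle generic_set generic_compl.
Proof.
move=> m phi M [c Hc] dM ess; rewrite expn1 in Hc dM ess *.
have [L [R LR]] := incomparable_columns dM; set k := 2 * m in Hc dM ess LR *.
have [d Hd] := semidecidable_and (semidecidable_select empty_oracle c (entries m k))
  (semidecidable_forces m k M L R empty_oracle).
have [l N|xs [l [N [s0 [/Hd [[sz phiV] fV] H]]]]] := @generic_approx_meets d.
  (* Density: the strings of [V] are longer than [l], so their codes exceed [l] and the given
     condition says nothing about them. *)
  have [V [vV gV pV]] := ess l.
  pose all_str := flatten [seq flatten [seq V i j | j <- iota 0 k] | i <- iota 0 m].
  have mem_all i j t : i < m -> j < k -> t \in V i j -> t \in all_str.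
    move=> li lj tV; apply/flatten_mapP; exists i; rewrite ?mem_iota //.
    by apply/flatten_mapP; exists j; rewrite ?mem_iota.
  pose l' := maxn l (\max_(t <- all_str) (enc t).+1).
  have lt_l' i j t : i < m -> j < k -> t \in V i j -> enc t < l'.
    move=> li lj /(mem_all _ _ _ li lj) ta; rewrite leq_max; apply/orP; right.
    exact: (@leq_bigmax_seq _ all_str xpredT (fun t => (enc t).+1)).
  have gt_l i j t : i < m -> j < k -> t \in V i j -> (enc t < l) = false.
    move=> li lj tV; apply/negbTE; rewrite -leqNgt.
    exact: leq_trans (ltnW (gV i j li lj t tV)) (leq_size_enc t).
  (* The extension keeps the old values and, beyond them, puts in exactly the strings of the left
     components. *)
  have [N' HN'] := bits_comprehension
    (fun x => if x < l then bit x N else has (fun i => bit x (setcode (V i (L i)))) (iota 0 m)) l'.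
  pose xs := [seq setcode (V (r %/ k) (r %% k)) | r <- iota 0 (m * k)].
  have nth_xs i j q : i < m -> j < k -> nth 0 (q :: xs) (entry k i j) = setcode (V i j).
    move=> li lj; have lt : i * k + j < m * k by nia.
    rewrite /= (nth_map 0) ?size_iota // nth_iota // add0n.
    by rewrite divnMDl ?(leq_ltn_trans _ lj) // divn_small // addn0 modnMDl modn_small.
  have sz_xs : size xs = m * k by rewrite size_map size_iota.
  exists xs, l', N'; split; last first.
  - by move=> x lt; rewrite HN' lt (leq_trans lt (leq_maxl _ _)).
  - exact: leq_maxl.
  apply/Hd; split.
    split; last first.
      rewrite (@map_entries m k V) => [|i j li lj]; first exact/Hc.
      by rewrite nth_xs.
    apply/allP => r /flatten_mapP[i]; rewrite mem_iota => li /mapP[j]; rewrite mem_iota => lj ->.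
    by rewrite /= sz_xs; exact: entry_ltn.
  move=> i; rewrite mem_iota => li; have [lL lR inc] := LR i li.
  have sze j : j < k -> entry k i j < size (pair l' N' :: xs).
    by rewrite [size _]/= sz_xs; exact: entry_ltn.
  split=> [j|]; first rewrite mem_iota => lj.
    by split; rewrite ?sze // nth_xs //; apply/in_coneP; exact: vV.
  split; split; rewrite ?sze // nth_xs //; apply/all_setcodeP => t tV.
    rewrite !(p1K, p2K) HN' (lt_l' _ _ _ _ _ tV) // (gt_l _ _ _ _ _ tV) //=.
    by apply/hasP; exists i; rewrite ?mem_iota ?bit_setcode.
  rewrite !(p1K, p2K) HN' (lt_l' _ _ _ _ _ tV) // (gt_l _ _ _ _ _ tV) //=.
  (* A string in both a right and a left component would extend two incomparable entries of the
     matrix. *)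
  apply/hasPn => i'; rewrite mem_iota bit_setcode => /= li'; apply/negP => tV'.
  have [lL' _ /(_ i li)] := LR i' li'; rewrite (@incomparable_prefix _ _ t) //.
    exact: vV tV'.
  exact: vV tV.
(* The condition has been met; its accompanying numbers are now decoded into the valuation
   sought. *)
have codes x : exists B, setcode B == x by have [B <-] := setcode_surj x; exists B.
pose B x := xchoose (codes x).
have BK x : setcode (B x) = x by apply/eqP; exact: (xchooseP (codes x)).
pose V i j := B (nth 0 (pair l N :: xs) (entry k i j)).
exists V; split.
- move=> i j li lj; have [|H1 _] := fV i; first by rewrite mem_iota.
  by have [|_ _] := H1 j; rewrite ?mem_iota // -[nth 0 _ (entry _ _ _)]BK => /in_coneP.
- move=> i li; have [lL lR _] := LR i li.
  have [|_ [[_ _ HL] [_ _ HR]]] := fV i; first by rewrite mem_iota.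
  exists (L i), (R i); split=> // t tV.
    move: HL; rewrite -[nth 0 _ (entry _ _ _)]BK => /all_setcodeP/(_ t tV).
    rewrite /= p1K p2K => /andP[lt b]; exists s0 => s le.
    by rewrite (H s le _ lt).
  move: HR; rewrite -[nth 0 _ (entry _ _ _)]BK => /all_setcodeP/(_ t tV).
  rewrite /= p1K p2K => /andP[lt b].
  have G := generic_set_cvg (fun s le => H s le _ lt).
  by move/G; rewrite (negbTE b).
- by apply/Hc; rewrite -(@map_entries m k V (pair l N :: xs)) // => i j _ _; rewrite BK.
Qed.

(** * Homogeneous sets are not fair *)

Section Homogeneous.
Variables (S : str -> Prop) (g : str -> str).
Hypothesis hom : homogeneous (fun s t => generic_approx (enc s) (enc t)) S g.

Lemma leq_size_homogeneous s : size s <= size (g s).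
Proof.
case: hom => _ _ _ gI gP; elim/last_ind: s => // s b IH; rewrite size_rcons.
apply: leq_ltn_trans IH _.
have := gP s (rcons s b); rewrite -cats1 prefix_prefix => /esym/prefixP[u E].
rewrite E size_cat; case: u E => [|x u] /= E; last by lia.
by move: E; rewrite cats0 => /gI/(congr1 size); rewrite size_cat /=; lia.
Qed.

(** Each element of [S] has proper extensions in [S] with arbitrarily large codes. As these codes
    serve as stages, the approximation takes the value [col] at arbitrarily late stages, so its
    limit is [col]. *)
Lemma homogeneous_limit : exists col : bool, forall t, S t -> generic_set t <-> col.
Proof.
case: (hom) => -[col Hcol] gS Sg gI gP; exists col => t St.
have [b [s0 H]] := generic_approx_cvg (enc t).
(* Appending [s0.+1] bits makes the extension proper even for [s0 = 0] and pushes its code past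
   [s0]. *)
have [s Es] := Sg t St; pose t' := g (s ++ nseq s0.+1 true).
have <- : b = col.
  rewrite -(Hcol t t' St (gS _)).
    rewrite H //; apply: leq_trans (leq_size_enc _); apply: leq_trans (leq_size_homogeneous _).
    by rewrite size_cat size_nseq; lia.
  rewrite /sprefix -Es -gP prefix_prefix; apply/eqP => /gI/(congr1 size).
  by rewrite size_cat size_nseq; lia.
exact: generic_set_cvg H.
Qed.

Lemma semidecidable_meets : exists c, forall B,
  halts (str_oracle S) c [:: setcode B] <-> exists2 t, t \in B & S t.
Proof.
pose chi x : bool := if excluded_middle_informative (str_oracle S x) then true else false.
have chiP x : chi x <-> str_oracle S x by rewrite /chi; case: excluded_middle_informative.
have cchi : computable (str_oracle S) (fun x => chi x).
  exists cOracle => x; case E: (chi x); first by apply: ev_orac1; apply/chiP.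
  by apply: ev_orac0 => /chiP; rewrite E.
have [|c Hc] := @search_code (str_oracle S) (fun x u => bit x u && chi x).
  have cc : computable (str_oracle S) (fun p => chi (p1 p)).
    exact: comp_comp cchi (comp_p1 (comp_id _)).
  by comp_auto.
exists c => B; rewrite Hc; split=> [[x /andP[b /chiP[t [E St]]]]|[t tB St]].
  by exists t => //; rewrite -bit_setcode E.
by exists (enc t); rewrite bit_setcode tB; apply/chiP; exists t.
Qed.

(** One row suffices: if both the component inside the set and the one inside its complement meet
    [S], then [S] has elements on both sides, contrary to [homogeneous_limit]. *)
Lemma homogeneous_not_fair n : ~ n_fair n (str_oracle S) generic_set generic_compl.
Proof.
case: (hom) => _ gS Sg gI gP; set k := 2 ^ n * 1.
pose phi (V : valuation) := forall j, j \in iota 0 k -> exists2 t, t \in V 0 j & S t.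
(* The strings made of [j] zeros and a one form an infinite antichain; [g] carries it into [S]. *)
pose code_str j := nseq j false ++ [:: true].
have code_inc j1 j2 : j1 != j2 -> incomparable (code_str j1) (code_str j2).
  wlog lt : j1 j2 / j1 < j2 => [W|_].
    rewrite neq_ltn => /orP[] lt; [|rewrite incomparable_sym]; apply: W => //;
      by rewrite neq_ltn lt.
  have E : code_str j2 = nseq j1 false ++ false :: code_str (j2 - j1.+1).
    rewrite /code_str -cat_cons -[_ :: nseq _ _]/(nseq (j2 - j1.+1).+1 false) catA -nseqD.
    by congr (nseq _ _ ++ _); lia.
  have pc s u v : prefix (nseq s false ++ u) (nseq s false ++ v) = prefix u v.
    by elim: s.
  by rewrite E /incomparable !pc.
move=> /(_ 1 phi (fun _ j => g (code_str j))) [||s|V [_ diag pV]].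
- have [c Hc] := semidecidable_meets.
  have [d Hd] := @semidecidable_all (str_oracle S) _ (iota 0 k)
    (fun j xs => all (fun i => i < size xs) [:: j] /\
       halts (str_oracle S) c (map (nth 0 xs) [:: j]))
    (fun j => semidecidable_select (str_oracle S) c [:: j]).
  exists d => V; rewrite Hd /valcode /= cats0.
  split=> H j jk; have lj := jk; rewrite mem_iota in lj.
    rewrite size_map size_iota (nth_map 0) ?size_iota // nth_iota // andbT; split=> //.
    by apply/Hc; exact: H.
  have [_] := H j jk; rewrite (nth_map 0) ?size_iota // nth_iota //; exact: (proj1 (Hc _)).
- by move=> i j1 j2 _ _ _ /code_inc; rewrite /incomparable -!gP.
(* Singletons of elements of [S] far above the matrix entries witness that the formula is
   essential. *)
- exists (fun _ j => [:: g (code_str j ++ nseq s.+1 true)]); split.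
  + by move=> i j _ _ t; rewrite inE => /eqP->; rewrite -gP prefix_prefix.
  + move=> i j _ _ t; rewrite inE => /eqP->; apply: leq_trans (leq_size_homogeneous _).
    by rewrite size_cat size_nseq; lia.
  + by move=> j _; exists (g (code_str j ++ nseq s.+1 true)); rewrite ?mem_head.
have [L [R [lL lR H0 H1]]] := diag 0 isT.
have [t tL St] : exists2 t, t \in V 0 L & S t by apply: pV; rewrite mem_iota.
have [u uR Su] : exists2 u, u \in V 0 R & S u by apply: pV; rewrite mem_iota.
have [col Hcol] := homogeneous_limit.
by apply: (H1 u uR); apply/(Hcol u Su)/(Hcol t St); exact: H0.
Qed.

End Homogeneous.

Theorem mainTheorem6 :
  exists (A0 A1 : str -> Prop) (f : str -> str -> bool),
    [/\ (forall s, A0 s \/ A1 s) /\ (forall s, ~ (A0 s /\ A1 s)),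
        Delta2_str A0,
        n_fair 1 empty_oracle A0 A1,
        computable_coloring f &
        forall (S : str -> Prop) (g : str -> str), homogeneous f S g ->
          forall n, 1 <= n -> ~ n_fair n (str_oracle S) A0 A1].
Proof.
exists generic_set, generic_compl, (fun s t => generic_approx (enc s) (enc t)); split.
- by split=> s; [exact: classic | case].
- exact: Delta2_generic_set.
- exact: one_fair_generic.
- exact: computable_generic_coloring.
- by move=> S g hom n _; exact: homogeneous_not_fair hom n.
Qed.
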